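(* Let $F_0^{\star}$ denote the smallest number of faces among all mono-monostatic convex polyhedral $0$-skeletons in $\mathbb{R}^3$, and let $V_0^{\star}$ denote the smallest number of vertices among all mono-monostatic convex polyhedral $0$-skeletons in $\mathbb{R}^3$. Then $F_0^{\star}\le 21$ and $V_0^{\star}\le 21$.
   Context: Let $P\subset\mathbb{R}^3$ be a $3$-dimensional convex polyhedron (a convex polytope with nonempty interior). $P$ is regarded as a polyhedral $0$-skeleton if its mass distribution consists of equal point masses placed at its vertices; its center of mass $c$ is then the arithmetic mean of its vertices, which lies in the interior of $P$. A point $q\in\mathrm{bd}\,P$ is an equilibrium point of $P$ (with respect to $c$) if the plane $H$ through $q$ perpendicular to the segment $[c,q]$ supports $P$ at $q$. The equilibrium point $q$ is nondegenerate if $H\cap P$ is the unique vertex, edge or face of $P$ that contains $q$ in its relative interior. A nondegenerate equilibrium point $q$ is called stable, saddle-type or unstable if $\dim(H\cap P)=2$, $1$ or $0$, respectively. Only polyhedra all of whose equilibrium points with respect to the center of mass are nondegenerate are considered. Such a polyhedron is mono-monostatic if it has exactly one stable equilibrium point and exactly one unstable equilibrium point. *)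

(* Defs.v *)
From HB Require Import structures.
From mathcomp Require Import all_boot all_order all_algebra finmap.
From mathcomp Require Import all_classical all_reals all_analysis.

Set Implicit Arguments.
Unset Strict Implicit.
Unset Printing Implicit Defensive.

Import Order.TTheory GRing.Theory Num.Theory.
Import numFieldNormedType.Exports.

Local Open Scope classical_set_scope.
Local Open Scope ring_scope.
Local Open Scope card_scope.

Section Polyhedra.
Variable R : realType.
Notation E := 'rV[R]_3.
Implicit Types (P A F : set E) (c q u v x : E) (d n : nat).

Definition dot u v : R := (u *m v^T) ord0 ord0.

Definition conv_hull A : set E := smallest (@convex_set R E) A.

Definition flat q (V : {vspace E}) : set E := [set x | x - q \in V].

Definition is_flat A := exists q (V : {vspace E}), A = flat q V.

Definition aff_hull A : set E := smallest is_flat A.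

Definition has_aff_dim A d :=
  exists q (V : {vspace E}), aff_hull A = flat q V /\ (\dim V)%VS = d.

Definition relint A : set E :=
  [set x | A x /\ \forall y \near x, aff_hull A y -> A y].

Definition bd A : set E := closure A `\` interior A.

Definition polyhedron P :=
  (exists2 A, finite_set A & P = conv_hull A) /\ interior P !=set0.

Definition plane q u : set E := [set x | dot (x - q) u = 0].

(* [u = 0] is excluded since [plane q 0] is the whole space. *)
Definition supports P q u :=
  [/\ u != 0, P q &
      (forall x, P x -> dot (x - q) u <= 0) \/
      (forall x, P x -> 0 <= dot (x - q) u)].

(* For a polytope every nonempty proper face is exposed, so these are exactly
   its vertices, edges and 2-dimensional faces. *)
Definition proper_face P F :=
  exists q u, supports P q u /\ F = plane q u `&` P.

Definition vertices P : set E := [set v | proper_face P [set v]].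

Definition facets P : set (set E) :=
  [set F | proper_face P F /\ has_aff_dim F 2].

Definition mass_center P : E :=
  (#|` fset_set (vertices P)|%:R)^-1 *: \sum_(v \in vertices P) v.

Definition equilibrium P c q := bd P q /\ supports P q (q - c).

(* The intersection of [P] with the plane through [q] perpendicular to the
   segment [c, q]. *)
Definition contact P c q : set E := plane q (q - c) `&` P.

Definition nondegenerate_at P c q :=
  [set F | proper_face P F /\ relint F q] = [set contact P c q].

(* Stable, saddle-type and unstable equilibria are those of type [d] equal to
   2, 1 and 0 respectively. *)
Definition equilibrium_of_type d P c q :=
  [/\ equilibrium P c q, nondegenerate_at P c q & has_aff_dim (contact P c q) d].

Definition stable := equilibrium_of_type 2.
Definition unstable := equilibrium_of_type 0.

Definition mono_monostatic P :=
  [/\ polyhedron P,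
      forall q, equilibrium P (mass_center P) q ->
        nondegenerate_at P (mass_center P) q,
      exists! q, stable P (mass_center P) q &
      exists! q, unstable P (mass_center P) q].

Definition mono_monostatic_faces : set nat :=
  [set n | exists P, mono_monostatic P /\ facets P #= `I_n].

Definition mono_monostatic_vertices : set nat :=
  [set n | exists P, mono_monostatic P /\ vertices P #= `I_n].

End Polyhedra.

Definition is_smallest (A : set nat) (m : nat) :=
  A m /\ forall n, A n -> (m <= n)%N.

(* Main.v *)
(**
  The polyhedron is a stack of five horizontal squares with vertices
  (+-a_i, +-a_i, z_i), for (a_i, z_i) = (2,-6), (6,-5), (7,-4), (9,-1), (10,6),
  completed by the apex (0,0,40).  Its 21 vertices sum to 0, so the center of
  mass is the origin.  The profile (a_i, z_i) is a discrete spiral, chosen so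
  that on every side face the distance to the origin increases strictly as one
  climbs the face along the lines through the intersection of its slanted
  edges: by convexity it suffices to check this at the bottom of the face, and
  there only at the midpoint and at the endpoints of the lower edge.  So no
  lateral boundary point other than the apex is an equilibrium, and the only
  equilibria are the center of the bottom square and the apex.
*)
From HB Require Import structures.
Require Import Defs.
From mathcomp Require Import all_boot all_order all_algebra.
From mathcomp Require Import all_classical all_reals all_analysis.
From mathcomp Require Import ring lra.

Set Implicit Arguments.
Unset Strict Implicit.
Unset Printing Implicit Defensive.

Import Order.TTheory GRing.Theory Num.Theory.
Import numFieldNormedType.Exports.

Local Open Scope classical_set_scope.
Local Open Scope ring_scope.
Local Open Scope card_scope.

(** * The inner product, short segments in neighbourhoods, orthogonal planes *)

Section DotProduct.
Variable R : realType.
Local Notation E := 'rV[R]_3.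
Implicit Types (P A F C : set E) (p q u v w x y : E).

Lemma dotE u v :
  dot u v = u ord0 0 * v ord0 0 + u ord0 1 * v ord0 1 + u ord0 2 * v ord0 2.
Proof.
rewrite /dot !mxE !big_ord_recl big_ord0 !mxE addr0 addrA.
by do 2?[congr (_ + _)]; congr (u _ _ * v _ _); apply/val_inj.
Qed.

Lemma dotC u v : dot u v = dot v u.
Proof. by rewrite !dotE; ring. Qed.

Lemma dotDl u v w : dot (u + v) w = dot u w + dot v w.
Proof. by rewrite !dotE !mxE; ring. Qed.

Lemma dotNl u w : dot (- u) w = - dot u w.
Proof. by rewrite !dotE !mxE; ring. Qed.

Lemma dotBl u v w : dot (u - v) w = dot u w - dot v w.
Proof. by rewrite dotDl dotNl. Qed.

Lemma dotZl a u w : dot (a *: u) w = a * dot u w.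
Proof. by rewrite !dotE !mxE; ring. Qed.

Lemma dotZr a u w : dot u (a *: w) = a * dot u w.
Proof. by rewrite dotC dotZl dotC. Qed.

Lemma dotNr u w : dot u (- w) = - dot u w.
Proof. by rewrite dotC dotNl dotC. Qed.

Definition dotr u x : R^o := dot x u.

Lemma dotr_is_linear u : linear (dotr u).
Proof. by move=> a v w; rewrite /dotr dotDl dotZl. Qed.

HB.instance Definition _ u :=
  GRing.isLinear.Build R E R^o _ (dotr u) (dotr_is_linear u).

Lemma row3P u v : u ord0 0 = v ord0 0 -> u ord0 1 = v ord0 1 ->
  u ord0 2 = v ord0 2 -> u = v.
Proof.
move=> e0 e1 e2; apply/rowP => -[[|[|[|//]]] i3].
- by have -> : Ordinal i3 = 0 by apply/val_inj.
- by have -> : Ordinal i3 = 1 by apply/val_inj.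
- by have -> : Ordinal i3 = 2 by apply/val_inj.
Qed.

Lemma dot_eq0 u : dot u u = 0 -> u = 0.
Proof.
rewrite dotE => h.
have [h0 h1 h2] : [/\ u ord0 0 = 0, u ord0 1 = 0 & u ord0 2 = 0].
  by split; nra.
by apply: row3P; rewrite ?h0 ?h1 ?h2 mxE.
Qed.

Lemma dot_gt0 u : u != 0 -> 0 < dot u u.
Proof.
move=> u0; rewrite lt_def (contra_neq (@dot_eq0 u) u0) dotE.
by nra.
Qed.

(** The component of [u] orthogonal to [v] is orthogonal to [u] as well, hence to itself, so it
    vanishes. *)
Lemma colinear u v : (forall w, dot w v = 0 -> dot w u = 0) ->
  exists c, u = c *: v.
Proof.
move=> h; exists (dot u v / dot v v).
have [v0|v0] := eqVneq v 0.
  rewrite [X in _ *: X]v0 scaler0; apply/dot_eq0/h; rewrite v0.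
  by rewrite !dotE !mxE; ring.
have vv : dot v v != 0 by rewrite gt_eqF// dot_gt0.
set c := _ / _; apply/eqP; rewrite -subr_eq0; apply/eqP/dot_eq0.
have wv : dot (u - c *: v) v = 0 by rewrite dotBl dotZl /c divfK ?subrr.
rewrite [X in dot X]lock dotC dotBl dotZl -lock.
by rewrite (dotC u) (dotC v) wv (h _ wv) mulr0 subr0.
Qed.

Lemma dot_continuous u : continuous (fun x => dot x u).
Proof.
have -> : (fun x => dot x u) =
    fun x => x ord0 0 * u ord0 0 + x ord0 1 * u ord0 1 + x ord0 2 * u ord0 2.
  by apply/funext => x; rewrite dotE.
have c i : continuous (fun x : E => x ord0 i * u ord0 i).
  by move=> x; apply: continuousM; [exact: coord_continuous|exact: cst_continuous].
by move=> x; exact: (cvgD (cvgD (c 0 x) (c 1 x)) (c 2 x)).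
Qed.

Lemma near_line P q u : (\forall y \near q, P y) ->
  exists2 e : R, 0 < e & forall t, `|t| <= e -> P (q + t *: u).
Proof.
move=> nP.
have ct : (fun t : R => q + t *: u) @ (0 : R) --> q.
  rewrite -[X in _ --> X]addr0 -(scale0r u).
  by apply: cvgD; [exact: cvg_cst|apply: cvgZr_tmp; exact: cvg_id].
have : \forall t \near (0 : R), P (q + t *: u) by exact: ct nP.
(* Halving the radius turns the open ball into the closed bound [|t| <= e]. *)
move=> /nbhs_ballP[e /= e0 eP]; exists (e / 2); first by rewrite divr_gt0.
move=> t te; apply: eP; rewrite /ball/= sub0r normrN.
by apply: (le_lt_trans te); rewrite ltr_pdivrMr// ltr_pMr// ltr1n.
Qed.

(** Around an interior point one can move both ways along [u], which puts points of [P] strictly on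
    both sides of the plane. *)
Lemma supports_not_interior P q u : supports P q u -> ~ interior P q.
Proof.
case=> u0 Pq h /(@near_line _ _ u)[e e0 eP].
have uu := dot_gt0 u0.
have h1 := eP e; have h2 := eP (- e).
rewrite normrN gtr0_norm// lexx in h1 h2.
move: {h1 h2}(h1 isT) (h2 isT) => h1 h2.
by case: h => h; move: (h _ h1) (h _ h2);
  rewrite ![q + _]addrC !addrK !dotZl; nra.
Qed.

Definition orthogonal u : {vspace E} := lker (linfun (dotr u)).

Lemma mem_orthogonal u x : (x \in orthogonal u) = (dot x u == 0).
Proof. by rewrite memv_ker lfunE. Qed.

(** Rank-nullity: for [u != 0] the functional [dotr u] is onto the one-dimensional space [R^o]. *)
Lemma dim_orthogonal u : u != 0 -> (\dim (orthogonal u) = 2)%N.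
Proof.
move=> u0; have := limg_ker_dim (linfun (dotr u)) fullv.
rewrite capfv dimvf dim_matrix -/(orthogonal u).
suff -> : (linfun (dotr u) @: fullv)%VS = fullv.
  by rewrite dimvf /dim/= addn1 => -[].
apply/vspaceP => c; rewrite memvf.
have -> : c = linfun (dotr u) ((c / dot u u) *: u).
  by rewrite lfunE /= /dotr dotZl divfK// gt_eqF// dot_gt0.
exact: memv_img (memvf _).
Qed.

End DotProduct.

(** * Facets of a polyhedron given by finitely many linear inequalities *)

Section HRepresentation.
Variables (R : realType) (I : finType) (N : I -> 'rV[R]_3) (b : I -> R).
Local Notation E := 'rV[R]_3.
Implicit Types (F : set E) (p q u v w x y : E).

Definition hpoly : set E := [set x | forall i, dot x (N i) <= b i].

Definition hface i : set E := [set x | dot x (N i) = b i] `&` hpoly.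

(** Such a point certifies that inequality [i] is irredundant: it lies in the relative interior of
    [hface i] and in no other [hface k]. *)
Definition only_active i p :=
  dot p (N i) = b i /\ forall k, k != i -> dot p (N k) < b k.

Lemma only_active_hface i p : only_active i p -> hface i p.
Proof.
case=> pi pk; split=> // k.
by have [->|/pk/ltW//] := eqVneq k i; rewrite pi.
Qed.

(** Continuity and finiteness of [I]; the predicate [D] allows the active constraint to be left
    out. *)
Lemma near_strict (D : pred I) q :
  (forall i, D i -> dot q (N i) < b i) ->
  \forall y \near q, forall i, D i -> dot y (N i) < b i.
Proof.
move=> qD.
have nD i : \forall y \near q, D i -> dot y (N i) < b i.
  have [Di|nDi] := boolP (D i); last first.
    by apply: (@filterE _ _ (nbhs_filter q)) => y; rewrite ?(negPf nDi).
  have : \forall y \near q, dot y (N i) < b i.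
    by apply: (cvgr_lt _ (@dot_continuous _ (N i) q)); exact: qD.
  by apply: filterS.
exact: (filter_forall (nbhs_filter q) nD).
Qed.

Lemma interior_hpoly q : (forall i, dot q (N i) < b i) -> interior hpoly q.
Proof.
move=> qN; have : \forall y \near q, forall i, predT i -> dot y (N i) < b i.
  exact: near_strict.
by apply: filterS => y yN i; exact/ltW/yN.
Qed.

Lemma only_active_near_line i p w : only_active i p -> dot w (N i) = 0 ->
  exists2 e : R, 0 < e & forall t, `|t| <= e -> hface i (p + t *: w).
Proof.
move=> [pi pk] wi.
have /near_strict/(near_line w)[e e0 eP] : forall k, k != i -> dot p (N k) < b k.
  exact: pk.
exists e => // t /eP tP; apply: only_active_hface.
by split; [rewrite dotDl dotZl wi mulr0 addr0|].
Qed.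

Lemma planeE p u : plane p u = [set x | dot x u = dot p u].
Proof.
by apply/seteqP; split=> x; rewrite /plane/= dotBl => /eqP;
  rewrite ?subr_eq0 => /eqP // ->; rewrite subrr.
Qed.

Lemma eq_plane p u v : u != 0 -> (forall w, dot w v = 0 -> dot w u = 0) ->
  plane p u = plane p v.
Proof.
move=> u0 /colinear[c ucv].
have c0 : c != 0 by apply: contra_neq u0; rewrite ucv => ->; rewrite scale0r.
rewrite !planeE; apply/seteqP; split=> x /=; rewrite ucv !dotZr; last by move=> ->.
exact: mulfI.
Qed.

(** For [w] orthogonal to [N i], both [p + e *: w] and [p - e *: w] stay in the body. The supporting
    functional is extremal at [p], so it vanishes on [w]; hence [u] is parallel to [N i]. *)
Lemma supports_plane i p q u : only_active i p -> supports hpoly q u ->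
  plane q u p -> plane q u = plane p (N i).
Proof.
move=> pi [u0 qP sq] pu.
have -> : plane q u = plane p u by move: pu; rewrite !planeE => /= ->.
apply: eq_plane => // w wi; have [e e0 eP] := only_active_near_line pi wi.
have := eP e; have := eP (- e).
rewrite normrN gtr0_norm// lexx => /(_ isT)[_ h1] /(_ isT)[_ h2].
move: pu; rewrite /plane/= dotBl => pu.
by case: sq => sq; move: (sq _ h1) (sq _ h2); rewrite !dotBl !dotDl !dotZl; nra.
Qed.

Lemma flat_orthogonal p u : flat p (orthogonal u) = plane p u.
Proof. by apply/seteqP; split=> x; rewrite /flat /plane/= mem_orthogonal => /eqP. Qed.

Lemma plane_only_active i p : only_active i p ->
  plane p (N i) = [set x | dot x (N i) = b i].
Proof. by case=> pi _; rewrite planeE pi. Qed.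

(** For [x] in the plane, the face contains [p] and a second point of the line from [p] towards [x],
    so every flat through the face contains [x]. *)
Lemma aff_hull_hface i p : only_active i p -> aff_hull (hface i) = plane p (N i).
Proof.
move=> pi; apply/seteqP; split.
  apply: smallest_sub; first by exists p, (orthogonal (N i)); rewrite flat_orthogonal.
  by rewrite (plane_only_active pi) => x [].
move=> x px _ [[q [V ->]] FV].
have [e e0 eP] := only_active_near_line pi px.
have h1 : p - q \in V by exact/FV/only_active_hface.
have h2 : p + e *: (x - p) - q \in V by apply/FV/eP; rewrite gtr0_norm.
have : e *: (x - p) \in V.
  by have := memvB h2 h1; congr (_ \in V); apply/rowP => k; rewrite !mxE; ring.
move=> /(memvZ e^-1); rewrite scalerA mulVf ?gt_eqF// scale1r => h3.
by rewrite /flat/=; have := memvD h3 h1; rewrite addrA subrK.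
Qed.

Lemma hface_dim i p : only_active i p -> N i != 0 -> has_aff_dim (hface i) 2.
Proof.
move=> pi Ni; exists p, (orthogonal (N i)).
by rewrite flat_orthogonal (aff_hull_hface pi) dim_orthogonal.
Qed.

Lemma hface_proper i p : only_active i p -> N i != 0 ->
  proper_face hpoly (hface i).
Proof.
move=> pi Ni; exists p, (N i); rewrite (plane_only_active pi); split=> //.
split=> //; first by have [] := only_active_hface pi.
by left=> x xP; rewrite dotBl pi.1 subr_le0.
Qed.

Lemma hface_relint i p : only_active i p -> relint (hface i) p.
Proof.
move=> pi; split; first exact: only_active_hface.
have /near_strict : forall k, k != i -> dot p (N k) < b k by case: pi.
apply: filterS => y yP; rewrite (aff_hull_hface pi) (plane_only_active pi) => yi.
exact: only_active_hface.
Qed.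

(** Otherwise each constraint is strict at some contact point. Averaging these points gives a
    contact point where all constraints are strict, that is, an interior point on a supporting
    plane. *)
Lemma supports_active q u : supports hpoly q u ->
  exists i, plane q u `&` hpoly `<=` [set x | dot x (N i) = b i].
Proof.
move=> sq; apply/not_existsP => nF.
have {}nF i : exists x, [/\ plane q u x, hpoly x & dot x (N i) < b i].
  have /existsNP[x /not_implyP[[ux xP] /eqP xi]] := nF i.
  by exists x; split=> //; rewrite lt_neqAle xi xP.
have [y [uy yP yI]] : exists y, [/\ plane q u y, hpoly y &
    forall i, i \in enum I -> dot y (N i) < b i].
  (* Each midpoint makes one more constraint strict and keeps the earlier ones strict. *)
  elim: (enum I) => [|i s [y [uy yP yI]]].
    by exists q; case: sq => _ qP _; split=> //; rewrite /plane/= dotBl subrr.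
  have [x [ux xP xi]] := nF i.
  exists (2^-1 *: (x + y)); split.
  - move: ux uy; rewrite /plane/= !dotBl !dotZl !dotDl => ux uy; lra.
  - by move=> k; rewrite dotZl dotDl; have := xP k; have := yP k; lra.
  - move=> k; rewrite inE dotZl dotDl => /predU1P[->|/yI].
      by have := yP i; lra.
    by have := xP k; lra.
have : supports hpoly y u.
  case: sq => u0 qP sq; split=> //.
  move: uy; rewrite /plane/= dotBl => uy.
  by case: sq => sq; [left|right] => x /sq; rewrite !dotBl; lra.
move=> /supports_not_interior; apply; apply: interior_hpoly => i.
by apply: yI; rewrite mem_enum.
Qed.

(** The face lies in the supporting plane and, by [supports_active], in some constraint plane. Its
    two-dimensional direction space fills both, so the two planes coincide. *)
Lemma facet_hface F : (forall i, N i != 0) -> facets hpoly F ->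
  exists i, F = hface i.
Proof.
move=> N0 [[p [u [sp ->]]] [q [V [FV V2]]]].
have [i Fi] := supports_active sp.
have [u0 pP _] := sp.
have pi : dot p (N i) = b i by apply: Fi; split=> //; rewrite planeE.
have sub n : n != 0 -> plane p u `&` hpoly `<=` plane p n -> V = orthogonal n.
  move=> n0 Fn; apply/eqP; rewrite eqEdim dim_orthogonal// V2 leqnn andbT.
  have VP : flat q V `<=` plane p n.
    rewrite -FV; apply: smallest_sub => //.
    by exists p, (orthogonal n); rewrite flat_orthogonal.
  apply/subvP => v vV; rewrite mem_orthogonal; apply/eqP.
  have := VP (q + v); have := VP q; rewrite /flat /plane/= subrr mem0v => /(_ isT).
  by rewrite addrAC subrr add0r vV !dotBl dotDl => h /(_ isT); lra.
exists i; rewrite /hface -pi -planeE; congr (_ `&` _).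
have Vu : V = orthogonal u by apply: sub => // x [].
have Vi : V = orthogonal (N i) by apply: sub => //; rewrite (planeE p (N i)) pi.
by apply: eq_plane => // w /eqP; rewrite -mem_orthogonal -Vi Vu mem_orthogonal => /eqP.
Qed.

Lemma facets_hpoly (p : I -> E) : (forall i, N i != 0) ->
  (forall i, only_active i (p i)) -> facets hpoly = range hface.
Proof.
move=> N0 pi; apply/seteqP; split=> F; first by case/facet_hface=> // i ->; exists i.
by case=> i _ <-; split; [exact: hface_proper (pi i) _|exact: hface_dim (pi i) _].
Qed.

Lemma hface_inj (p : I -> E) : (forall i, only_active i (p i)) -> injective hface.
Proof.
move=> pi i j eqF; apply/eqP/negPn/negP => ij.
have : hface j (p i) by rewrite -eqF; exact: only_active_hface.
by case=> h _; have [_ /(_ j)] := pi i; rewrite h ltxx eq_sym => /(_ ij).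
Qed.

End HRepresentation.

(** * Vertices of convex hulls, and criteria for stable and unstable equilibria *)

Section ConvexHulls.
Variable R : realType.
Local Notation E := 'rV[R]_3.
Implicit Types (A C P F : set E) (c p q u v w x y : E).

Lemma convexP C : @convex_set R E C <->
  forall x y t, C x -> C y -> 0 <= t -> t <= 1 -> C (t *: x + (1 - t) *: y).
Proof.
split=> [cC x y t Cx Cy t0 t1|cC x y t /set_mem Cx /set_mem Cy].
  by have := cC x y (Itv01 t0 t1); rewrite !inE; apply.
by apply/mem_set; apply: cC.
Qed.

Lemma convex_halfspace u (a : R) : @convex_set R E [set x | dot x u <= a].
Proof.
by apply/convexP => x y t /= xa ya t0 t1; rewrite dotDl !dotZl; nra.
Qed.

Lemma convex_open_halfspace u (a : R) : @convex_set R E [set x | dot x u < a].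
Proof.
apply/convexP => x y t /= xa ya t0 t1; rewrite dotDl !dotZl.
have [->|tn0] := eqVneq t 0; first by rewrite mul0r add0r subr0 mul1r.
have {}t0 : 0 < t by rewrite lt_def tn0.
nra.
Qed.

(** An open half-space together with one boundary point stays convex. Hence a point strictly exposed
    in a generating set is still strictly exposed in its hull. *)
Lemma convex_exposed v w :
  @convex_set R E [set x | x = v \/ dot x w < dot v w].
Proof.
apply/convexP => x y t /= hx hy t0 t1; rewrite dotDl !dotZl.
have [->|tn0] := eqVneq t 0.
  by rewrite scale0r subr0 scale1r add0r mul0r mul1r add0r.
have [->|tn1] := eqVneq t 1.
  by rewrite subrr scale0r scale1r addr0 mul0r mul1r addr0.
have {}t0 : 0 < t by rewrite lt_def tn0.
have {}t1 : t < 1 by rewrite lt_def eq_sym tn1.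
case: hx => [->|hx]; case: hy => [->|hy]; try (right; nra).
by left; rewrite -scalerDl addrC subrK scale1r.
Qed.

Lemma convex_hpoly (I : finType) (N : I -> E) (b : I -> R) :
  @convex_set R E (hpoly N b).
Proof.
apply/convexP => x y t xP yP t0 t1 i.
have /convexP := @convex_halfspace (N i) (b i).
by apply; [exact: xP|exact: yP| |].
Qed.

Lemma supports_le P q u : supports P q u ->
  exists v, plane q v = plane q u /\ forall x, P x -> dot x v <= dot q v.
Proof.
case=> _ _ [] h; [exists u|exists (- u)].
  by split=> // x /h; rewrite dotBl subr_le0.
split=> [|x /h]; last by rewrite dotBl !dotNr lerN2 subr_ge0.
by rewrite !planeE; apply/seteqP; split=> x /=; rewrite !dotNr; [move/oppr_inj|move->].
Qed.

(** If a vertex of the hull were outside [A], all of [A], hence the whole hull, would lie strictly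
    on one side of its supporting plane. The converse is [convex_exposed]. *)
Lemma vertices_conv_hull A :
  (forall v, A v -> exists2 w, w != 0 &
    forall x, A x -> x != v -> dot x w < dot v w) ->
  vertices (conv_hull A) = A.
Proof.
move=> exA; apply/seteqP; split=> v.
  case=> q [u [sq vE]].
  have [w [wu wP]] := supports_le sq.
  have {}vE : [set v] = plane q w `&` conv_hull A by rewrite wu.
  have [vq vH] : (plane q w `&` conv_hull A) v by rewrite -vE.
  move: vq; rewrite planeE /= => vq.
  apply: contrapT => nAv.
  have : conv_hull A `<=` [set x | dot x w < dot v w].
    apply: smallest_sub; first exact: convex_open_halfspace.
    move=> x Ax; have Hx : conv_hull A x by exact: sub_gen_smallest.
    rewrite /= lt_def vq wP// andbT; apply/eqP => xq.
    have : [set v] x by rewrite vE planeE.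
    by move=> xv; apply: nAv; rewrite -xv.
  by move=> /(_ _ vH)/=; rewrite ltxx.
move=> Av; have [w w0 wA] := exA _ Av.
have sub : conv_hull A `<=` [set x | x = v \/ dot x w < dot v w].
  apply: smallest_sub; first exact: convex_exposed.
  by move=> x Ax /=; have [->|/(wA _ Ax)] := eqVneq x v; [left|right].
have Hv : conv_hull A v by exact: sub_gen_smallest.
exists v, w; split.
  split=> //; left=> x /sub[->|]; rewrite dotBl; lra.
rewrite planeE; apply/seteqP; split=> x /=; first by move=> ->.
by case=> xv /sub[//|]; rewrite xv ltxx.
Qed.

Lemma aff_hull_set1 v : aff_hull [set v] = [set v].
Proof.
apply/seteqP; split; last exact: sub_gen_smallest.
apply: smallest_sub => //; exists v, 0%VS.
apply/seteqP; split=> x; rewrite /flat/= memv0 subr_eq0 => /eqP //.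
Qed.

Lemma has_aff_dim_set1 v d : has_aff_dim [set v] d <-> d = 0%N.
Proof.
split=> [[q [V []]]|->]; last first.
  exists v, 0%VS; rewrite dimv0 aff_hull_set1; split=> //.
  by apply/seteqP; split=> x; rewrite /flat/= memv0 subr_eq0 => /eqP.
rewrite aff_hull_set1 => vV <-; apply/eqP; rewrite dimv_eq0 -subv0.
have qv : [set v] q by rewrite vV /flat/= subrr mem0v.
apply/subvP => w wV; rewrite memv0.
have : flat q V (q + w) by rewrite /flat/= addrAC subrr add0r.
by rewrite -vV -qv => /(canRL (addKr _)) ->; rewrite addNr.
Qed.

Lemma has_aff_dim0 A x y : has_aff_dim A 0 -> A x -> A y -> x = y.
Proof.
case=> q [V [AV /eqP]]; rewrite dimv_eq0 => /eqP V0.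
have h z : A z -> z = q.
  move=> Az; have : flat q V z by rewrite -AV; exact: sub_gen_smallest.
  by rewrite /flat/= V0 memv0 subr_eq0 => /eqP.
by move=> /h -> /h ->.
Qed.

(** At a point where only constraint [i] is active, every supporting plane is that of facet [i]. So
    the contact set is this facet, and so is every proper face through [q]. *)
Lemma stable_only_active (I : finType) (N : I -> E) (b : I -> R) i c q :
  only_active N b i q -> N i != 0 -> supports (hpoly N b) q (q - c) ->
  stable (hpoly N b) c q.
Proof.
move=> qi Ni sq; have [_ qP _] := sq.
have pqi : plane q (q - c) = plane q (N i).
  by apply: supports_plane qi sq _; rewrite planeE.
have ci : contact (hpoly N b) c q = hface N b i.
  by rewrite /contact pqi (plane_only_active qi).
split; last by rewrite ci; exact: hface_dim qi Ni.
  by split=> //; split; [exact: subset_closure|exact: supports_not_interior sq].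
apply/seteqP; split=> F /=; last first.
  by move=> ->; rewrite ci; split; [exact: hface_proper qi Ni|exact: hface_relint].
case=> -[p [u [sp ->]]] [[pq _] _]; rewrite /contact pqi.
by rewrite (supports_plane qi sp).
Qed.

Lemma contact_exposed P c q : P q ->
  (forall x, P x -> x != q -> dot x (q - c) < dot q (q - c)) ->
  contact P c q = [set q].
Proof.
move=> Pq Pmax; apply/seteqP; split=> x /=; last first.
  by move=> ->; split=> //; rewrite planeE.
case; rewrite planeE /= => xq Px; apply/eqP/negPn/negP => /(Pmax _ Px).
by rewrite xq ltxx.
Qed.

(** The contact set is [[set q]]. A face with [q] in its relative interior has no other point [x]:
    prolonging the segment from [x] slightly beyond [q] would stay in [P] and exceed the maximum at
    [q]. *)
Lemma unstable_exposed P c q : q != c -> P q ->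
  (forall x, P x -> x != q -> dot x (q - c) < dot q (q - c)) -> unstable P c q.
Proof.
move=> qc Pq Pmax.
have sq : supports P q (q - c).
  split=> //; first by rewrite subr_eq0.
  left=> x Px; rewrite dotBl subr_le0.
  by have [->//|/(Pmax _ Px)/ltW] := eqVneq x q.
have cq := contact_exposed Pq Pmax.
split; last by rewrite cq; apply/has_aff_dim_set1.
  by split=> //; split; [exact: subset_closure|exact: supports_not_interior sq].
apply/seteqP; split=> F /=; last first.
  move=> ->; split; first by exists q, (q - c).
  rewrite cq; split=> //.
  by apply: (@filterE _ _ (nbhs_filter q)) => y; rewrite aff_hull_set1.
case=> -[p [u [sp FE]]] [Fq Fnear]; rewrite cq.
apply/seteqP; split=> [x Fx|x ->//]; apply/eqP/negPn/negP => xq.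
have [e e0 /(_ e)] := near_line (q - x) Fnear.
rewrite gtr0_norm// lexx => /(_ isT) h.
have : F (q + e *: (q - x)).
  apply: h => _ [[r [V ->]] FV].
  rewrite /flat/= addrAC; apply: rpredD; first exact: FV.
  apply: rpredZ.
  by rewrite -[q](subrK r) -addrA -opprB opprB -(opprB x r) rpredB ?FV.
have Px : P x by move: Fx; rewrite FE => -[].
have := Pmax _ Px xq; rewrite FE => qx [_ /Pmax].
have [|_ /(_ isT)] := eqVneq (q + e *: (q - x)) q; last first.
  by rewrite dotDl dotZl dotBl; nra.
move=> /(canRL (addKr _)); rewrite addNr => /eqP.
by rewrite scaler_eq0 gt_eqF//= subr_eq0 eq_sym (negPf xq).
Qed.

End ConvexHulls.

(** * Coordinates, vertices and face inequalities of the explicit polyhedron *)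

Section Body.
Variable R : realType.
Local Notation E := 'rV[R]_3.

Definition pt (x y z : R) : E := \row_j nth 0 [:: x; y; z] j.

Lemma pt_eta (u : E) : u = pt (u ord0 0) (u ord0 1) (u ord0 2).
Proof. by apply: row3P; rewrite mxE. Qed.

Lemma dot_pt x y z x' y' z' :
  dot (pt x y z) (pt x' y' z') = x * x' + y * y' + z * z'.
Proof. by rewrite dotE !mxE. Qed.

Lemma ptD x y z x' y' z' :
  pt x y z + pt x' y' z' = pt (x + x') (y + y') (z + z').
Proof. by apply: row3P; rewrite !mxE. Qed.

Lemma ptZ a x y z : a *: pt x y z = pt (a * x) (a * y) (a * z).
Proof. by apply: row3P; rewrite !mxE. Qed.

Lemma pt0 : pt 0 0 0 = 0.
Proof. by apply: row3P; rewrite !mxE. Qed.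

Lemma pt_eq0 x y z : (pt x y z == 0) = [&& x == 0, y == 0 & z == 0].
Proof.
apply/eqP/and3P => [/rowP e|[/eqP-> /eqP-> /eqP->]]; last exact: pt0.
by have := (e 0, e 1, e 2); rewrite !mxE /= => -[[-> ->] ->].
Qed.

Definition sgn (s : bool) : R := if s then -1 else 1.

(* Half-width and height of the layers; layer 5 is the apex. *)
Definition hw i : R := nth 0 [:: 2; 6; 7; 9; 10; 0] i.
Definition ht i : R := nth 0 [:: -6; -5; -4; -1; 6; 40] i.

(* The side faces between layers i and i + 1 lie in the planes
   lD i * |x| = lA i + lB i * z and lD i * |y| = lA i + lB i * z. *)
Definition lD i : R := nth 0 [:: 1; 1; 3; 7; 17] i.
Definition lA i : R := nth 0 [:: 26; 11; 29; 64; 200] i.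
Definition lB i : R := nth 0 [:: 4; 1; 2; 1; -5] i.

(** One type indexes both vertices and facets. [None] is the apex or the bottom face; [Some] holds a
    layer with two signs for a vertex, or a layer, an axis and a sign for a side face. *)
Definition idx : finType := option ('I_5 * bool * bool).

Definition vtx (k : idx) : E :=
  if k is Some (i, s, t) then pt (sgn s * hw i) (sgn t * hw i) (ht i)
  else pt 0 0 40.

Definition nrm (k : idx) : E :=
  if k is Some (i, ax, s) then
    if ax then pt (sgn s * lD i) 0 (- lB i) else pt 0 (sgn s * lD i) (- lB i)
  else pt 0 0 (-1).

Definition bnd (k : idx) : R := if k is Some (i, _, _) then lA i else 6.

Definition body := hpoly nrm bnd.

(** The five side inequalities written out with numerals for [lra]: [x] is at most the half-width of
    the body at height [z], a concave function of [z]. *)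
Definition layers (x z : R) := [/\ x <= 26 + 4 * z, x <= 11 + z,
  3 * x <= 29 + 2 * z, 7 * x <= 64 + z & 17 * x <= 200 - 5 * z].

Lemma layersP x z :
  layers x z <-> forall i : 'I_5, lD i * x - lB i * z <= lA i.
Proof.
split=> [[h0 h1 h2 h3 h4]|h].
  by case=> [[|[|[|[|[|//]]]]] i5]; rewrite /lD /lB /lA /=;
    [move: h0|move: h1|move: h2|move: h3|move: h4]; clear; lra.
by split; [have := h 0|have := h 1|have := h 2|have := h 3|have := h 4];
  rewrite /lD /lB /lA /=; clear; lra.
Qed.

Lemma bodyP x y z : body (pt x y z) <->
  [/\ -6 <= z, layers x z, layers (- x) z, layers y z & layers (- y) z].
Proof.
split=> [h|[z6]].
  split; first by have := h None; rewrite /= dot_pt; lra.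
  - apply/layersP => i.
    by have := h (Some (i, true, false)); rewrite /= dot_pt /sgn; lra.
  - apply/layersP => i.
    by have := h (Some (i, true, true)); rewrite /= dot_pt /sgn; lra.
  - apply/layersP => i.
    by have := h (Some (i, false, false)); rewrite /= dot_pt /sgn; lra.
  - apply/layersP => i.
    by have := h (Some (i, false, true)); rewrite /= dot_pt /sgn; lra.
move=> /layersP hx /layersP hNx /layersP hy /layersP hNy.
case=> [[[i [] []]]|]; rewrite /= dot_pt /sgn; last lra.
- by have := hNx i; lra.
- by have := hx i; lra.
- by have := hNy i; lra.
- by have := hy i; lra.
Qed.

(** * A point in the relative interior of each facet *)

Definition fw i : R := (hw i + hw i.+1) / 2.
Definition fz i : R := (ht i + ht i.+1) / 2.

Definition facet_pt (k : idx) : E :=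
  if k is Some (i, ax, s) then
    if ax then pt (sgn s * fw i) 0 (fz i) else pt 0 (sgn s * fw i) (fz i)
  else pt 0 0 (-6).

Lemma fw_gt0 i : (i < 5)%N -> 0 < fw i.
Proof. by case: i => [|[|[|[|[|//]]]]] _; rewrite /fw /hw /=; lra. Qed.

Lemma lD_gt0 i : (i < 5)%N -> 0 < lD i.
Proof. by case: i => [|[|[|[|[|//]]]]] _; rewrite /lD /=; lra. Qed.

Lemma lA_gt0 i : (i < 5)%N -> 0 < lA i.
Proof. by case: i => [|[|[|[|[|//]]]]] _; rewrite /lA /=; lra. Qed.

Lemma facet_eq i : (i < 5)%N -> lD i * fw i - lB i * fz i = lA i.
Proof.
by case: i => [|[|[|[|[|//]]]]] _; rewrite /lD /lB /lA /fw /fz /hw /ht /=; lra.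
Qed.

(** The profile is strictly concave at its layers, so the midpoint of one profile edge is strictly
    below the lines of the others. *)
Lemma facet_lt i k : (i < 5)%N -> (k < 5)%N -> k != i ->
  lD k * fw i - lB k * fz i < lA k.
Proof.
by case: i => [|[|[|[|[|//]]]]] _; case: k => [|[|[|[|[|//]]]]] // _ _;
  rewrite /lD /lB /lA /fw /fz /hw /ht /=; lra.
Qed.

Lemma facet_lt0 i k : (i < 5)%N -> (k < 5)%N -> - (lB k * fz i) < lA k.
Proof.
by case: i => [|[|[|[|[|//]]]]] _; case: k => [|[|[|[|[|//]]]]] // _;
  rewrite /lB /lA /fz /ht /=; lra.
Qed.

Lemma fz_gt i : (i < 5)%N -> -6 < fz i.
Proof. by case: i => [|[|[|[|[|//]]]]] _; rewrite /fz /ht /=; lra. Qed.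

Lemma bottom_lt k : (k < 5)%N -> 6 * lB k < lA k.
Proof. by case: k => [|[|[|[|[|//]]]]] _; rewrite /lB /lA /=; lra. Qed.

Lemma only_active_facet_pt k : only_active nrm bnd k (facet_pt k).
Proof.
case: k => [[[i ax] s]|]; split; last 1 first.
- case=> [[[k ax'] s']|//] _.
  by have := bottom_lt (ltn_ord k); case: ax'; rewrite /= dot_pt; lra.
- by have := facet_eq (ltn_ord i); case: ax s => [] []; rewrite /= dot_pt /sgn; lra.
- case=> [[[k ax'] s']|_]; last first.
    by have := fz_gt (ltn_ord i); case: ax; rewrite /= dot_pt; lra.
  have h0 := facet_lt0 (ltn_ord i) (ltn_ord k).
  have := mulr_gt0 (lD_gt0 (ltn_ord k)) (fw_gt0 (ltn_ord i)).
  (* In the same layer the three other faces are handled by [h0] and the positive product; other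
     layers also need [facet_lt]. *)
  have [ki|ki] := eqVneq k i.
    rewrite ki in h0 *; case: ax s ax' s' => [] [] [] []; rewrite ?eqxx // => h1 _;
    by rewrite /= dot_pt /sgn; lra.
  have := facet_lt (ltn_ord i) (ltn_ord k) ki.
  by move=> h1 h2 _; case: ax s ax' s' => [] [] [] []; rewrite /= dot_pt /sgn; lra.
- by rewrite /= dot_pt; lra.
Qed.

Lemma bnd_gt0 k : 0 < bnd k.
Proof. by case: k => [[[i ax] s]|]; rewrite //= lA_gt0. Qed.

(** A zero normal would turn the equality at [facet_pt k] into [0 = bnd k]. *)
Lemma nrm_neq0 k : nrm k != 0.
Proof.
have [h _] := only_active_facet_pt k; apply/eqP => k0.
by have := bnd_gt0 k; rewrite -h k0 dotC dotE !mxE !mul0r !addr0 ltxx.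
Qed.

Lemma interior_body0 : interior body 0.
Proof. by apply: interior_hpoly => k; rewrite dotE !mxE !mul0r !addr0 bnd_gt0. Qed.

(* Strictly between the slopes of the two profile edges meeting at layer i, so
   that the layer is the unique maximum of hw - slope i * ht. *)
Definition slope i : R := nth 0 [:: 5; 2; 4 / 5; 1 / 3; 0] i.

(** For [Some (i, s, t)], this functional is at most [2 * (hw k - slope i * ht k)] on layer [k],
    with equality at the corner of signs [s], [t]; the 2 arises because both horizontal coordinates
    contribute. *)
Definition exposing (k : idx) : E :=
  if k is Some (i, s, t) then pt (sgn s) (sgn t) (- (2 * slope i))
  else pt 0 0 1.

Lemma hw_gt0 i : (i < 5)%N -> 0 < hw i.
Proof. by case: i => [|[|[|[|[|//]]]]] _; rewrite /hw /=; lra. Qed.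

Lemma ht_lt i : (i < 5)%N -> ht i < 40.
Proof. by case: i => [|[|[|[|[|//]]]]] _; rewrite /ht /=; lra. Qed.

Lemma exposing_lt i k : (i < 5)%N -> (k < 6)%N -> k != i ->
  hw k - slope i * ht k < hw i - slope i * ht i.
Proof.
by case: i => [|[|[|[|[|//]]]]] _; case: k => [|[|[|[|[|[|//]]]]]] // _ _;
  rewrite /hw /ht /slope /=; lra.
Qed.

Lemma vtx_exposed j k : k != j ->
  dot (vtx k) (exposing j) < dot (vtx j) (exposing j).
Proof.
case: j k => [[[i s] t]|] [[[k s'] t']|] //; last first.
- by move=> _; have := ht_lt (ltn_ord k); rewrite /= !dot_pt; lra.
(* The apex is treated as layer 5, of half-width 0. *)
- move=> _; have := exposing_lt (ltn_ord i) (ltnSn 5).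
  have i5 : 5%N != i by rewrite gtn_eqF.
  move=> /(_ i5); rewrite {1}/hw {1}/ht /=.
  by case: s t => [] []; rewrite /= !dot_pt /sgn; lra.
have hk := hw_gt0 (ltn_ord k); have [->|ki] := eqVneq k i.
  have hi := hw_gt0 (ltn_ord i).
  by case: s t s' t' => [] [] [] []; rewrite ?eqxx // => _; rewrite /= !dot_pt /sgn; lra.
have := exposing_lt (ltn_ord i) (leqW (ltn_ord k)) ki => h _.
by case: s t s' t' => [] [] [] []; rewrite /= !dot_pt /sgn; lra.
Qed.

Lemma exposing_neq0 k : exposing k != 0.
Proof.
by case: k => [[[i s] t]|]; rewrite /= pt_eq0 ?oner_eq0 ?andbF//;
  case: s; rewrite /sgn ?oppr_eq0 oner_eq0.
Qed.

Lemma vtx_inj : injective vtx.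
Proof.
move=> j k jk; apply/eqP/negPn/negP => /vtx_exposed.
by rewrite jk ltxx.
Qed.

Lemma vertices_body : vertices (conv_hull (range vtx)) = range vtx.
Proof.
apply: vertices_conv_hull => _ [j _ <-]; exists (exposing j).
  exact: exposing_neq0.
move=> _ [k _ <-] kj; apply: vtx_exposed; apply: contra_neq kj => ->.
by [].
Qed.

Implicit Types (x y z a r : R).

(** * Agreement of the inequalities with the convex hull of the vertices *)

Lemma layers_le x a z : x <= a -> layers a z -> layers x z.
Proof. by move=> xa [? ? ? ? ?]; split; lra. Qed.

Lemma layers_hw i : (i < 6)%N -> layers (hw i) (ht i).
Proof.
by case: i => [|[|[|[|[|[|//]]]]]] _; rewrite /hw /ht /=; split; lra.
Qed.

Lemma hw_ge0 i : 0 <= hw i.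
Proof. by case: i => [|[|[|[|[|[|i]]]]]]; rewrite /hw /= ?nth_nil; lra. Qed.

Lemma ht_ge i : (i < 6)%N -> -6 <= ht i.
Proof. by case: i => [|[|[|[|[|[|//]]]]]] _; rewrite /ht /=; lra. Qed.

Lemma body_square a x y z : layers a z -> -6 <= z ->
  - a <= x <= a -> - a <= y <= a -> body (pt x y z).
Proof.
move=> az z6 /andP[ax xa] /andP[ay ya].
by apply/bodyP; split=> //; apply: layers_le az; lra.
Qed.

Lemma body_vtx k : body (vtx k).
Proof.
case: k => [[[i s] t]|] /=; last first.
  by apply: (@body_square 0); rewrite ?oppr0 ?lexx//; [split; lra|lra].
have i6 := leqW (ltn_ord i); have := hw_ge0 i => h0.
apply: (@body_square (hw i)); [exact: layers_hw|exact: ht_ge|..].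
  by case: s; rewrite /sgn; lra.
by case: t; rewrite /sgn; lra.
Qed.

Lemma profile_eq i j : (i < 5)%N -> (j == i) || (j == i.+1) ->
  lD i * hw j = lA i + lB i * ht j.
Proof.
by case: i => [|[|[|[|[|//]]]]] _ /orP[] /eqP->;
  rewrite /lD /lA /lB /hw /ht /=; lra.
Qed.

Lemma ht_ltS i : (i < 5)%N -> ht i < ht i.+1.
Proof. by case: i => [|[|[|[|[|//]]]]] _; rewrite /ht /=; lra. Qed.

Lemma find_layer z : -6 <= z -> z < 40 ->
  exists2 i, (i < 5)%N & ht i <= z < ht i.+1.
Proof.
move=> z6 z40.
have [h|h] := ltP z (-5); first by exists 0%N; rewrite // /ht /=; lra.
have [h1|h1] := ltP z (-4); first by exists 1%N; rewrite // /ht /=; lra.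
have [h2|h2] := ltP z (-1); first by exists 2%N; rewrite // /ht /=; lra.
have [h3|h3] := ltP z 6; first by exists 3%N; rewrite // /ht /=; lra.
by exists 4%N; rewrite // /ht /=; lra.
Qed.

Section Hull.
Variable C : set E.
Hypothesis convC : @convex_set R E C.

Lemma convex_pt t x y z x' y' z' : C (pt x y z) -> C (pt x' y' z') ->
  0 <= t -> t <= 1 ->
  C (pt (t * x + (1 - t) * x') (t * y + (1 - t) * y') (t * z + (1 - t) * z')).
Proof.
by move=> Cp Cq t0 t1; rewrite -ptD -!ptZ; apply: (convexP _).1.
Qed.

Lemma convex_segment a x : - a <= x -> x <= a -> exists t,
  [/\ 0 <= t, t <= 1 & x = t * a + (1 - t) * - a].
Proof.
move=> ax xa; have [a0|a0] := eqVneq a 0.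
  by exists 0; split; lra.
have {}a0 : 0 < a by rewrite lt_def a0; lra.
exists ((a + x) / (2 * a)); split; last by field; rewrite gt_eqF.
  by rewrite divr_ge0//; lra.
by rewrite ler_pdivrMr; lra.
Qed.

Lemma convex_square a x y z : (forall s t, C (pt (sgn s * a) (sgn t * a) z)) ->
  - a <= x <= a -> - a <= y <= a -> C (pt x y z).
Proof.
move=> Ca /andP[ax xa] /andP[ay ya].
have Cx t : C (pt x (sgn t * a) z).
  have [c [c0 c1 ->]] := convex_segment ax xa.
  have := convex_pt (Ca false t) (Ca true t) c0 c1.
  rewrite /sgn mul1r mulN1r -!mulrDl.
  by rewrite [c + _]addrC subrK !mul1r.
have [c [c0 c1 ->]] := convex_segment ay ya.
have := convex_pt (Cx false) (Cx true) c0 c1.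
by rewrite /sgn mul1r mulN1r -!mulrDl [c + _]addrC subrK !mul1r.
Qed.

Hypothesis vtxC : forall k, C (vtx k).

Lemma convex_corner i s t : (i < 6)%N ->
  C (pt (sgn s * hw i) (sgn t * hw i) (ht i)).
Proof.
rewrite ltnS leq_eqVlt => /predU1P[->|i5].
  by have := vtxC None; rewrite /hw /ht /= !mulr0.
by have := vtxC (Some (Ordinal i5, s, t)).
Qed.

(** The slice at height [z] lies in a square whose corners are on the segments joining corresponding
    corners of two consecutive layers. *)
Lemma body_sub_convex : body `<=` C.
Proof.
move=> q; rewrite (pt_eta q).
move: (q _ 0) (q _ 1) (q _ 2) => x y z /bodyP[z6 hx hNx hy hNy].
(* From height 40 on, the topmost inequalities leave only the apex. *)
have [z40|z40] := leP 40 z.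
  case: hx hNx hy hNy => [_ _ _ _ hx] [_ _ _ _ hNx] [_ _ _ _ hy] [_ _ _ _ hNy].
  have -> : x = 0 by lra.
  have -> : y = 0 by lra.
  have -> : z = 40 by lra.
  exact: (vtxC None).
have [i i5 /andP[zi iz]] := find_layer z6 z40.
have := ht_ltS i5 => hi.
pose t := (ht i.+1 - z) / (ht i.+1 - ht i).
have t0 : 0 <= t by rewrite divr_ge0//; lra.
have t1 : t <= 1 by rewrite ler_pdivrMr; lra.
have zE : z = t * ht i + (1 - t) * ht i.+1.
  by rewrite /t; field; rewrite gt_eqF// subr_gt0.
pose a := t * hw i + (1 - t) * hw i.+1.
(* The line of edge [i] passes through layers [i] and [i.+1], hence through their interpolation. *)
have aE : lD i * a = lA i + lB i * z.
  have -> : lD i * a = t * (lD i * hw i) + (1 - t) * (lD i * hw i.+1).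
    by rewrite /a; ring.
  by rewrite zE !profile_eq ?eqxx ?orbT//; ring.
have D0 := lD_gt0 i5.
have le_a w : layers w z -> w <= a.
  move=> /layersP /(_ (Ordinal i5))/= wi.
  by rewrite -(ler_pM2l D0) aE; lra.
apply: (@convex_square a); last 2 first.
- by rewrite lerNl !le_a.
- by rewrite lerNl !le_a.
move=> s s'; have := convex_pt (convex_corner s s' (ltnW i5 : (i < 6)%N))
  (convex_corner s s' (i5 : (i.+1 < 6)%N)) t0 t1.
rewrite -zE; congr (C (pt _ _ _)); rewrite /a; ring.
Qed.

End Hull.

Lemma body_conv_hull : body = conv_hull (range vtx).
Proof.
apply/seteqP; split=> [q bq C [cC sC]|].
  by apply: body_sub_convex bq => // k; apply: sC; exists k.
apply: smallest_sub; first exact: convex_hpoly.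
by move=> _ [k _ <-]; exact: body_vtx.
Qed.

(** * Equilibrium points of the body with respect to the origin *)

(** With [r = (x ^+ 2 + y ^+ 2) / a], the expression is [lD i] times the derivative in [z] of half
    the squared distance to the origin, along the face with [x / a] and [y / a] fixed. The extremes
    [r = a] and [r = 2 * a] are the midpoint and the ends of a side of the horizontal square. *)
Lemma layer_slope i a z r : (i < 5)%N -> ht i <= z < ht i.+1 ->
  lD i * a = lA i + lB i * z -> a <= r <= 2 * a -> 0 < lB i * r + lD i * z.
Proof.
by case: i => [|[|[|[|[|//]]]]] _;
  rewrite /lD /lA /lB /ht /=; lra.
Qed.

Lemma layer_pos i a z : (i < 5)%N -> ht i <= z < ht i.+1 ->
  lD i * a = lA i + lB i * z -> 0 < a.
Proof.
by case: i => [|[|[|[|[|//]]]]] _;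
  rewrite /lD /lA /lB /ht /=; lra.
Qed.

(** By concavity, line [i] is the lowest of the five at heights of layer [i]. This covers points on
    an edge shared by two layers, where the face known to be active may be the lower one. *)
Lemma layer_le i j a z : (i < 5)%N -> (j < 5)%N -> ht i <= z < ht i.+1 ->
  lD j * a = lA j + lB j * z -> lA i + lB i * z <= lD i * a.
Proof.
by case: i => [|[|[|[|[|//]]]]] _; case: j => [|[|[|[|[|//]]]]] _;
  rewrite /lD /lA /lB /ht /=; lra.
Qed.

(* The second point is obtained by climbing the side face up to the next layer
   with the ratios x / a and y / a fixed. *)
Lemma climb i a x y z : (i < 5)%N -> ht i <= z < ht i.+1 ->
  lD i * a = lA i + lB i * z -> - a <= x <= a -> - a <= y <= a ->
  x ^+ 2 = a ^+ 2 \/ y ^+ 2 = a ^+ 2 ->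
  exists2 p, body p & 0 < dot (p - pt x y z) (pt x y z).
Proof.
move=> i5 zi aE xa ya xya; have a0 := layer_pos i5 zi aE.
pose r := (x ^+ 2 + y ^+ 2) / a.
have ra : a <= r <= 2 * a.
  rewrite ler_pdivlMr// ler_pdivrMr//.
  by case: xya => xya; apply/andP; split; nra.
have rs := layer_slope i5 zi aE ra; have D0 := lD_gt0 i5.
have iz : ht i < ht i.+1 by exact: ht_ltS.
pose b := hw i.+1; have b0 : 0 <= b by exact: hw_ge0.
have bE : lD i * b = lA i + lB i * ht i.+1 by rewrite profile_eq ?eqxx ?orbT.
have scale w : - a <= w <= a -> - b <= w / a * b <= b.
  move=> /andP[aw wa].
  have h1 : - 1 <= w / a by rewrite ler_pdivlMr// mulN1r.
  have h2 : w / a <= 1 by rewrite ler_pdivrMr// mul1r.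
  by apply/andP; split; nra.
exists (pt (x / a * b) (y / a * b) (ht i.+1)).
  by apply: (@body_square b); rewrite ?scale// ?ht_ge//; exact: layers_hw.
rewrite dotBl !dot_pt -(pmulr_rgt0 _ D0).
have -> : lD i * (x / a * b * x + y / a * b * y + ht i.+1 * z -
    (x * x + y * y + z * z)) =
  (lD i * b - lD i * a) * r + lD i * ((ht i.+1 - z) * z).
  by rewrite /r; field; rewrite gt_eqF.
rewrite bE aE.
(* The path is straight, so the product is the height gained times the quantity made positive by
   [layer_slope]. *)
have -> : (lA i + lB i * ht i.+1 - (lA i + lB i * z)) * r
    + lD i * ((ht i.+1 - z) * z) = (ht i.+1 - z) * (lB i * r + lD i * z) by ring.
by rewrite mulr_gt0// subr_gt0; case/andP: zi.
Qed.

Lemma equilibrium_body q : supports body q q -> q = pt 0 0 (-6) \/ q = pt 0 0 40.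
Proof.
move=> [q0 qb sq].
(* The origin is in the body and gives a negative value, which fixes the side of the plane. *)
have {sq} le p : body p -> dot (p - q) q <= 0.
  case: sq => sq bp; first exact: sq.
  have := sq 0 (interior_subset interior_body0).
  by rewrite sub0r dotNl oppr_ge0 leNgt dot_gt0.
move: q0 qb le; rewrite (pt_eta q).
move: (q _ 0) (q _ 1) (q _ 2) => x y z q0 qb le.
have [z6 hx hNx hy hNy] := (bodyP x y z).1 qb.
have [[k [kN kA]]|nA] := pselect (exists k, k != None /\ dot (pt x y z) (nrm k) = bnd k).
  right; case: k kN kA => [[[j ax] s]|//] _ kA.
  (* The coordinate along the active side face; it is the half-width at height [z], hence bounds
     [|x|] and [|y|]. *)
  pose a := if ax then sgn s * x else sgn s * y.
  have aE : lD j * a = lA j + lB j * z.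
    by move: kA; rewrite /a /=; case: ax {a}; rewrite dot_pt; lra.
  have az : layers a z.
    by rewrite /a /sgn; case: (ax) (s) => -[]; rewrite ?mul1r ?mulN1r.
  have le_a w : layers w z -> w <= a.
    move=> /layersP /(_ j) wj.
    by rewrite -(ler_pM2l (lD_gt0 (ltn_ord j))) aE; lra.
  have [z40|z40] := leP 40 z.
    have := az => -[_ _ _ _ a200].
    have := (le_a _ hx, le_a _ hNx, le_a _ hy, le_a _ hNy) => -[[[? ?] ?] ?].
    by congr pt; lra.
  have [i i5 zi] := find_layer z6 z40.
  have aEi : lD i * a = lA i + lB i * z.
    apply/eqP; rewrite eq_le (layer_le i5 (ltn_ord j) zi aE) andbT.
    by have /layersP /(_ (Ordinal i5))/= := az; lra.
  have xa : - a <= x <= a by rewrite lerNl !le_a.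
  have ya : - a <= y <= a by rewrite lerNl !le_a.
  have [|p /le] := climb i5 zi aEi xa ya; last by rewrite leNgt => /negP.
  by rewrite /a /sgn; case: ax s {kA a aE az le_a aEi xa ya} => -[];
    rewrite ?mul1r ?mulN1r ?sqrrN; [left|left|right|right].
have : forall k, k != None -> dot (pt x y z) (nrm k) < bnd k.
  move=> k kN; rewrite lt_neqAle qb andbT; apply/eqP => kA.
  by apply: nA; exists k.
(* With no side face active, a small horizontal move away from the axis stays in the body; the
   support inequality then forces [x = y = 0]. *)
move=> /near_strict/(near_line (pt x y 0))[e e0 /(_ e)].
rewrite gtr0_norm// lexx => /(_ isT) h.
have : body (pt x y z + e *: pt x y 0).
  move=> [k|]; first exact/ltW/h.
  by rewrite /= ptZ ptD dot_pt; lra.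
move=> /le; rewrite addrAC subrr add0r ptZ dot_pt => xy0.
have xy : x * x + y * y <= 0 by rewrite -(pmulr_rle0 _ e0); lra.
have x0 : x = 0 by nra.
have y0 : y = 0 by nra.
(* On the axis, comparison with the bottom centre and the apex excludes every height except -6, 0
   and 40. *)
have := le _ (only_active_hface (only_active_facet_pt None)).2.
have := le _ (body_vtx None).
rewrite /= !dotBl !dot_pt x0 y0; case: hx => _ _ _ _; rewrite x0 => z40 lt lb.
have [zlt|zgt|zeq] := ltgtP z 0.
- by left; congr pt; nra.
- by right; congr pt; nra.
- by move: q0; rewrite x0 y0 zeq pt0 eqxx.
Qed.

(** * Counting, the center of mass, and the conclusion *)

Lemma card_idx : #|{: idx}| = 21%N.
Proof. by rewrite card_option !card_prod card_ord card_bool. Qed.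

Lemma card_setT_idx : [set: idx] #= `I_21%N.
Proof.
rewrite -card_idx; apply: card_eq_trans (card_esym card_II).
have -> : [set: 'I_#|{: idx}|] = enum_rank @` [set: idx].
  by apply/seteqP; split=> // i _; exists (enum_val i) => //; exact: enum_valK.
by rewrite card_eq_sym; apply: inj_card_eq => j k _ _; exact: enum_rank_inj.
Qed.

(** Horizontal coordinates cancel by sign; vertically [4 * (-6 - 5 - 4 - 1 + 6) + 40 = 0]. *)
Lemma sum_vtx : \sum_(k : idx) vtx k = 0.
Proof.
rewrite (bigD1 None)//= (reindex_omap Some id)/=; last by case.
rewrite (eq_bigl xpredT); last by move=> k; rewrite eqxx.
pose F (p : 'I_5 * bool) t := vtx (Some (p, t)).
rewrite (eq_bigr (fun p => F p.1 p.2)); last by case.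
rewrite -(pair_bigA _ F)/= (eq_bigr (fun p => F (p.1, p.2) true + F (p.1, p.2) false));
  last by case=> i s _; rewrite big_bool.
rewrite -(pair_bigA _ (fun i s => F (i, s) true + F (i, s) false))/=.
rewrite !big_ord_recl big_ord0 addr0 !big_bool /F /= !ptD -pt0.
by congr pt; rewrite /sgn /hw /ht /=; lra.
Qed.

Lemma mass_center_body : mass_center body = 0.
Proof.
rewrite /mass_center body_conv_hull vertices_body.
rewrite (fsbig_image (R := E)); last by move=> j k _ _; exact: vtx_inj.
suff -> : \sum_(k \in [set: idx]) vtx k = \sum_(k : idx) vtx k.
  by rewrite sum_vtx scaler0.
rewrite -big_enum /= [RHS]fsbig_seq ?enum_uniq//.
suff -> : [set: idx] = [set` enum idx] by [].
by apply/seteqP; split=> k //= _; rewrite mem_enum.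
Qed.

Lemma mono_monostatic_body : mono_monostatic body.
Proof.
rewrite /mono_monostatic mass_center_body.
set bot := pt 0 0 (-6); set top := pt 0 0 40.
have Sbot : stable body 0 bot.
  apply: (stable_only_active (only_active_facet_pt None)); first exact: nrm_neq0.
  rewrite subr0; split.
  - by rewrite /= pt_eq0 !eqxx oppr_eq0 pnatr_eq0.
  - by have [] := only_active_hface (only_active_facet_pt None).
  - left=> x /(_ None); rewrite (pt_eta x) /= dotBl !dot_pt; lra.
have bt : body top := body_vtx None.
have top_max u : body u -> u != top -> dot u (top - 0) < dot top (top - 0).
  rewrite (pt_eta u) subr0.
  move: (u _ 0) (u _ 1) (u _ 2) => x y z /bodyP[z6 hx hNx hy hNy] ut.
  rewrite !dot_pt; apply: contra_neqT ut; rewrite -leNgt => z40.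
  case: hx hNx hy hNy => [_ _ _ _ hx] [_ _ _ _ hNx] [_ _ _ _ hy] [_ _ _ _ hNy].
  by congr pt; lra.
have contact_top : contact body 0 top = [set top] by exact: contact_exposed.
have Utop : unstable body 0 top.
  by apply: unstable_exposed => //; rewrite pt_eq0 !eqxx pnatr_eq0.
have eqE q : equilibrium body 0 q -> q = bot \/ q = top.
  by case=> _; rewrite subr0 => /equilibrium_body.
have [eqb ndb db] := Sbot; have [eqt ndt dt] := Utop.
split.
- split; last by exists 0; exact: interior_body0.
  exists (range vtx); last exact: body_conv_hull.
  by apply: finite_image; exact: finite_finset.
- by move=> q /eqE[]->.
(* The apex is not stable, since its contact set is a single point, of dimension 0. *)
- exists bot; split=> // q [/eqE[]-> // _].
  by rewrite contact_top => /has_aff_dim_set1.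
- exists top; split=> // q [/eqE[]-> // _ /has_aff_dim0 h].
  (* The bottom point is not unstable: its contact set contains two distinct corners of the bottom
     square. *)
  have b2 v : - 2 <= v <= 2 -> contact body 0 bot (pt v 2 (-6)).
    move=> v2; split; first by rewrite planeE /= subr0 !dot_pt; lra.
    by apply: (@body_square 2) => //; [split; lra|lra].
  have : pt 2 2 (-6) = pt (-2) 2 (-6) by apply: h; apply: b2; lra.
  by move=> /rowP /(_ 0); rewrite !mxE /= => e; exfalso; clear -e; lra.
Qed.

Lemma vertices_card : vertices body #= `I_21%N.
Proof.
rewrite body_conv_hull vertices_body; apply: card_eq_trans card_setT_idx.
by apply: inj_card_eq => j k _ _; exact: vtx_inj.
Qed.

Lemma facets_card : facets body #= `I_21%N.
Proof.
rewrite (facets_hpoly nrm_neq0 only_active_facet_pt).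
apply: card_eq_trans card_setT_idx.
by apply: inj_card_eq => j k _ _; exact: (hface_inj only_active_facet_pt).
Qed.

End Body.

Lemma exists_smallest (A : set nat) n : A n ->
  exists2 m, is_smallest A m & (m <= n)%N.
Proof.
move=> An; have ex : exists k, `[< A k >] by exists n; exact/asboolP.
case: (ex_minnP ex) => m /asboolP Am mmin; exists m.
  by split=> // k /asboolP /mmin.
by apply: mmin; exact/asboolP.
Qed.

Theorem theorem1 (R : realType) :
  exists F0 V0 : nat,
    [/\ is_smallest (mono_monostatic_faces R) F0,
        is_smallest (mono_monostatic_vertices R) V0,
        (F0 <= 21)%N & (V0 <= 21)%N].
Proof.
have [|F0 hF F21] := @exists_smallest (mono_monostatic_faces R) 21.
  by exists (@body R); split; [exact: mono_monostatic_body|exact: facets_card].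
have [|V0 hV V21] := @exists_smallest (mono_monostatic_vertices R) 21.
  by exists (@body R); split; [exact: mono_monostatic_body|exact: vertices_card].
by exists F0, V0.
Qed.
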